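(* Let $\alpha$ be a word consisting of $m$ letters $x$ and $n$ letters $y$, where $x,y$ satisfy $yx=w(1,1)xy+y$, $x\,w(s,t)=w(s+1,t)\,x$, $y\,w(s,t)=w(s,t+1)\,y$ for all $s,t\in\mathbb{N}$. Then in this algebra \[ \alpha=\sum_{k=0}^{m} f_k(w;B_\alpha)\,x^{m-k}y^{n}. \]
   Context: $(w(s,t))_{s,t\in\mathbb{N}}$ are commuting indeterminates; the algebra is generated by $x,y$ and the $w(s,t)$ subject to the three relations above. The Ferrers board $B_\alpha$ is the set of cells $(i,j)$ (column $i$, row $j$) with $1\le i\le m$, $1\le j\le h_i$, where $h_i$ is the number of $y$'s preceding the $i$-th $x$ in $\alpha$. A file placement of $k$ rooks in $B$ is a $k$-subset $Q\subseteq B$ with no two cells in the same column (several rooks may share a row); $\mathcal{F}_k(B)$ is the set of these. A rook cancels all cells below it in its column; $U_B(Q)$ is the set of cells of $B\setminus Q$ not cancelled by any rook of $Q$. For a cell $(i,j)$, $r_{Q,(i,j)}$ is the number of rooks of $Q$ in its north-west region, i.e. at cells $(i',j')$ with $i'<i$ and $j'\ge j$. The weighted file number is $f_k(w;B)=\sum_{Q\in\mathcal{F}_k(B)}\prod_{(s,t)\in U_B(Q)}w(s-r_{Q,(s,t)},t)$. *)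

(* Defs.v *)
From mathcomp Require Import all_boot all_order all_algebra.
Set Implicit Arguments.
Unset Strict Implicit.
Unset Printing Implicit Defensive.
Import GRing.Theory.
Local Open Scope ring_scope.

Variant letter := X | Y.

Definition is_x (l : letter) : bool := if l is X then true else false.
Definition is_y (l : letter) : bool := ~~ is_x l.

Definition word_val (A : pzRingType) (x y : A) (alpha : seq letter) : A :=
  \prod_(l <- alpha) (if is_x l then x else y).

(* [col_height alpha i] is h_i, with columns numbered from 1: the list below
   runs over the positions p of the letters x in alpha. *)
Definition col_height (alpha : seq letter) (i : nat) : nat :=
  nth 0%N [seq count is_y (take p alpha)
          | p <- iota 0 (size alpha) & is_x (nth Y alpha p)] i.-1.

(* A cell is a pair (column, row); rows are numbered from bottom to top.
   Coordinates start at 1, so a board with m columns and n rows lives in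
   'I_m.+1 * 'I_n.+1, whose cells with a zero coordinate are unused. *)
Definition ferrers_board (m n : nat) (alpha : seq letter) :
    {set 'I_m.+1 * 'I_n.+1} :=
  [set c : 'I_m.+1 * 'I_n.+1 | (1 <= c.1 <= m)%N && (1 <= c.2 <= col_height alpha c.1)%N].

Definition file_placements (M N k : nat) (B : {set 'I_M * 'I_N}) :
    {set {set 'I_M * 'I_N}} :=
  [set Q : {set 'I_M * 'I_N} |
    [&& Q \subset B, #|Q| == k &
        [forall c in Q, forall d in Q, (c.1 == d.1) ==> (c == d)]]].

Definition uncancelled (M N : nat) (B Q : {set 'I_M * 'I_N}) :
    {set 'I_M * 'I_N} :=
  [set c in B :\: Q | ~~ [exists d in Q, (d.1 == c.1) && (c.2 < d.2)%N]].

Definition nw_rooks (M N : nat) (Q : {set 'I_M * 'I_N}) (c : 'I_M * 'I_N) :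
    nat :=
  #|[set d in Q | (d.1 < c.1)%N && (c.2 <= d.2)%N]|.

(* The ambient ring is not commutative; the product is independent of the
   order of its factors only when the w s t commute with each other.
   The subtraction never truncates when Q is a file placement in a board
   without column 0: there is at most one rook in each of the columns
   1, ..., s - 1. *)
Definition file_number (A : pzRingType) (w : nat -> nat -> A) (M N k : nat)
    (B : {set 'I_M * 'I_N}) : A :=
  \sum_(Q in file_placements k B)
    \prod_(c in uncancelled B Q) w (c.1 - nw_rooks Q c)%N c.2.

(* Main.v *)
Require Import Defs.
From mathcomp Require Import all_boot all_order all_algebra.
Set Implicit Arguments.
Unset Strict Implicit.
Unset Printing Implicit Defensive.
Import GRing.Theory.
Local Open Scope ring_scope.

(** Reading [y x w(s,t)] in two ways shows that [w(s,t) y] does not depend on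
    [s] once [t >= 2].  Multiply a word on the right by [x]: each placement [Q]
    of [k] rooks contributes [x^(m-k) y^n x], and
    [y^n x = w(1,1)...w(1,n) x y^n + sum_j w(1,j+1)...w(1,n) y^n],
    the [j]-th summand being a rook in row [j] of the new column.  Moving
    [x^(m-k)] to the right gives the cell of row [t] the weight
    [w(m+1-k,t)] instead of [w(m+1-r,t)], where [r <= k] is the number of rooks
    in rows [>= t].  These agree on row 1, where [r = k]; on the other rows the
    independence of [s] makes the two products equal. *)

(** Permutations are generated by exchanges of adjacent blocks, and the products over two such
    blocks commute. The invariant [P] carries the commutation hypothesis along. *)
Lemma perm_prod_comm (A : pzRingType) (T : eqType) (F : T -> A)
    (r1 r2 : seq T) :
  {in r1 &, forall i j, GRing.comm (F i) (F j)} -> perm_eq r1 r2 ->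
  \prod_(i <- r1) F i = \prod_(i <- r2) F i.
Proof.
move=> Fcomm eq_r.
pose P s := {in s &, forall i j, GRing.comm (F i) (F j)} /\
  \prod_(i <- r1) F i = \prod_(i <- s) F i.
suff: P r2 by case.
apply: (catCA_perm_ind _ eq_r); last by split.
move=> s1 s2 s3 [comm_s prod_s]; split.
  by move=> i j; rewrite !(perm_mem (permEl (perm_catCA s2 s1 s3))); apply: comm_s.
rewrite prod_s !big_cat /= !mulrA; congr (_ * _).
rewrite (big_seq _ _ s1) (big_seq _ _ s2).
apply: commr_prod => j j2; apply: commr_sym; apply: commr_prod => i i1.
by apply: comm_s; rewrite !mem_cat ?i1 ?j2 ?orbT.
Qed.

(** * Moving weights through powers of [x] and [y] *)

Section Weights.
Variables (A : pzRingType) (x y : A) (w : nat -> nat -> A).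
Hypothesis w_comm : forall s t s' t' : nat,
  (0 < s)%N -> (0 < t)%N -> (0 < s')%N -> (0 < t')%N ->
  w s t * w s' t' = w s' t' * w s t.
Hypothesis yx : y * x = w 1%N 1%N * x * y + y.
Hypothesis xw : forall s t : nat, (0 < s)%N -> (0 < t)%N ->
  x * w s t = w s.+1 t * x.
Hypothesis yw : forall s t : nat, (0 < s)%N -> (0 < t)%N ->
  y * w s t = w s t.+1 * y.

(* Both ways of moving [w s t] to the left through [y * x] agree. *)
Lemma weight_row_y s t : (0 < s)%N -> (1 < t)%N -> w s t * y = w 1 t * y.
Proof.
case: t => // t; rewrite ltnS => + t0; elim: s => // -[|s] IH // _.
rewrite -{}IH //; set s1 := s.+1.
have E1 : y * x * w s1 t = w s1.+1 t.+1 * (w 1 1 * x * y) + w s1.+1 t.+1 * y.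
  by rewrite -mulrA xw // mulrA yw // -mulrA yx mulrDr.
have E2 : y * x * w s1 t = w s1.+1 t.+1 * (w 1 1 * x * y) + w s1 t.+1 * y.
  rewrite yx mulrDl -[_ * y * w s1 t]mulrA yw //.
  rewrite [in LHS]mulrA -(mulrA (w 1%N 1%N) x) xw //.
  by rewrite mulrA w_comm // -!mulrA.
exact: (addrI _ (etrans (esym E1) E2)).
Qed.

(* When no rook is placed in the new column, [y] is shielded by an [x]; the
   factor of row 1 removes it, as [w 1 1 * x * y = y * x - y]. *)
Lemma weight_row_wxy s t :
  (0 < s)%N -> (1 < t)%N -> w s t * (w 1 1 * x * y) = w 1 t * (w 1 1 * x * y).
Proof.
move=> s0 t1; have -> : w 1 1 * x * y = y * x - y by rewrite yx addrK.
by rewrite !mulrBr !mulrA !(@weight_row_y s t).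
Qed.

Lemma mul_exp_weight p s t :
  (0 < s)%N -> (0 < t)%N -> x ^+ p * w s t = w (p + s) t * x ^+ p.
Proof.
move=> s0 t0; elim: p => [|p IH]; first by rewrite expr0 mul1r mulr1.
by rewrite exprS -mulrA IH mulrA xw ?addn_gt0 ?s0 ?orbT // -mulrA.
Qed.

Lemma prod_weight_exp p (e : nat -> nat) (r : seq nat) :
  {in r, forall t, (0 < t)%N && (p < e t)%N} ->
  \prod_(t <- r) w (e t) t * x ^+ p = x ^+ p * \prod_(t <- r) w (e t - p) t.
Proof.
elim: r => [|t r IH] er; first by rewrite !big_nil mulr1 mul1r.
have /andP[t0 pt] := er _ (mem_head _ _).
rewrite !big_cons -mulrA IH => [|u ur]; last by apply: er; rewrite inE ur orbT.
by rewrite mulrA [RHS]mulrA mul_exp_weight ?subn_gt0 // subnKC // ltnW.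
Qed.

(** A first index may be changed only directly before [z]. Since the weights commute, each factor in
    turn is brought there, changed and moved back. *)
Lemma eq_prod_weight_mul (e e' : nat -> nat) (r : seq nat) z :
  {in r, forall t, [&& (0 < t)%N, (0 < e t)%N & (0 < e' t)%N]} ->
  {in r, forall t, w (e t) t * z = w (e' t) t * z} ->
  \prod_(t <- r) w (e t) t * z = \prod_(t <- r) w (e' t) t * z.
Proof.
elim: r => [|t r IH] e0 ez; first by rewrite !big_nil.
have sub_r: {subset r <= t :: r} by move=> u ur; rewrite inE ur orbT.
have /and3P[t0 et e't] := e0 _ (mem_head _ _).
rewrite !big_cons -!mulrA IH; [|by move=> u /sub_r /e0|by move=> u /sub_r /ez].
have comm_r s : (0 < s)%N ->
    w s t * \prod_(u <- r) w (e' u) u = \prod_(u <- r) w (e' u) u * w s t.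
  move=> s0; rewrite big_seq; apply: commr_prod => u /sub_r /e0 /and3P[u0 _ e'u].
  exact: w_comm.
by rewrite !mulrA !comm_r // -!mulrA ez ?mem_head.
Qed.

(** A rook in row [j] forces [b > 0], so once [x ^+ p] has moved left the weights stand before a
    [y]. They lie in rows at least 2, where [weight_row_y] resets the first index to 1. *)
Lemma column_with_rook p (e : nat -> nat) j b :
  (0 < j <= b)%N -> (forall t, (p < e t)%N) ->
  \prod_(j.+1 <= t < b.+1) w (e t) t * (x ^+ p * y ^+ b) =
  x ^+ p * (\prod_(j.+1 <= t < b.+1) w 1 t * y ^+ b).
Proof.
move=> /andP[j0 jb] pe.
have pos t : t \in index_iota j.+1 b.+1 -> (1 < t)%N.
  by rewrite mem_index_iota => /andP[+ _]; apply: leq_ltn_trans.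
rewrite mulrA prod_weight_exp => [|t /pos t1]; last by rewrite pe (ltnW t1).
rewrite -mulrA; congr (_ * _); apply: (@eq_prod_weight_mul _ (fun=> 1%N)) => t /pos t1.
  by rewrite (ltnW t1) subn_gt0 pe.
case: b jb {pos} => [|b] jb; first by move: j0; rewrite ltnNge jb.
by rewrite exprS !mulrA weight_row_y // subn_gt0.
Qed.

(** One [x] remains between the weights and [y ^+ b]. For [b > 0], the condition on [e 1] makes the
    factor of row 1 equal to [w 1 1], and [weight_row_wxy] handles the other rows. *)
Lemma column_without_rook p (e : nat -> nat) b :
  (forall t, (p < e t)%N) -> e 1%N = p.+1 ->
  \prod_(1 <= t < b.+1) w (e t) t * (x ^+ p.+1 * y ^+ b) =
  x ^+ p * (\prod_(1 <= t < b.+1) w 1 t * x * y ^+ b).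
Proof.
move=> pe e1; case: b => [|b].
  by rewrite !big_geq // !mul1r expr0 !mulr1 exprSr.
rewrite exprSr -(mulrA _ x) mulrA prod_weight_exp; last first.
  by move=> t; rewrite mem_index_iota pe => /andP[->].
rewrite -!mulrA; congr (_ * _).
(* The factor of row 1 goes last, so that [w 1 1 * x * y] stands to the right of the rows from 2
   on. *)
have comm1 (f : nat -> nat) : (forall t, 0 < f t)%N ->
    \prod_(1 <= t < b.+2) w (f t) t = \prod_(2 <= t < b.+2) w (f t) t * w (f 1) 1.
  move=> f0; rewrite big_ltn // big_nat; apply: commr_prod => t /andP[t2 _].
  by apply: w_comm; rewrite // ltnW.
rewrite comm1 => [|t]; last by rewrite subn_gt0.
rewrite (comm1 (fun=> 1%N)) // e1 subSnn -!mulrA exprS.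
rewrite !(mulrA (w 1%N 1%N)) !(mulrA (w 1%N 1%N * x)) mulrA [RHS]mulrA.
congr (_ * _); apply: (@eq_prod_weight_mul _ (fun=> 1%N)) => t;
  rewrite mem_index_iota => /andP[t1 _].
  by rewrite (ltnW t1) subn_gt0 pe.
by rewrite weight_row_wxy // subn_gt0.
Qed.

Lemma y_prod_row j b :
  y * \prod_(j.+1 <= t < b.+1) w 1 t = \prod_(j.+2 <= t < b.+2) w 1 t * y.
Proof.
rewrite [in RHS]big_add1 /=; have [bj|jb] := leqP b j.
  by rewrite !big_geq // mulr1 mul1r.
elim: b jb => // b IH; rewrite ltnS => jb; rewrite !(big_nat_recr b.+1) //= mulrA.
case: (ltngtP j b) jb => // [/IH->|->] _; first by rewrite -!mulrA yw.
by rewrite !big_geq // mulr1 !mul1r yw.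
Qed.

(** One more [y] on the left shifts all rows up by one. A rook in row [j] moves to row [j.+1]; in
    the term without rook, [y * x] splits into the new term without rook and a rook in row 1. *)
Lemma exp_y_mul_x b :
  y ^+ b * x = \prod_(1 <= t < b.+1) w 1 t * x * y ^+ b
    + \sum_(1 <= j < b.+1) \prod_(j.+1 <= t < b.+1) w 1 t * y ^+ b.
Proof.
elim: b => [|b IH].
  by rewrite !big_geq // expr0 mul1r mulr1 addr0.
rewrite exprS -mulrA IH mulrDr !mulrA y_prod_row -(mulrA _ y x) yx.
rewrite mulrDr mulrDl -!mulrA -exprS -addrA; congr (_ + _).
  rewrite [in RHS]big_ltn // !mulrA; congr (_ * _ * _).
  apply: commr_sym; rewrite big_nat; apply: commr_prod => t /andP[t2 _].
  by apply: w_comm; rewrite // ltnW.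
rewrite [in RHS]big_ltn //; congr (_ + _).
rewrite mulr_sumr [in RHS]big_add1 /=; apply: eq_big_nat => j _.
by rewrite mulrA y_prod_row -mulrA -exprS.
Qed.

End Weights.

(** * Column heights of a word extended by one letter *)

Definition col_heights (alpha : seq letter) : seq nat :=
  [seq count is_y (take p alpha)
  | p <- iota 0 (size alpha) & is_x (nth Y alpha p)].

Lemma col_heights_rcons alpha l :
  col_heights (rcons alpha l) =
  if is_x l then rcons (col_heights alpha) (count is_y alpha)
  else col_heights alpha.
Proof.
rewrite /col_heights size_rcons -addn1 iotaD /= add0n filter_cat map_cat /=.
rewrite nth_rcons ltnn eqxx.
have -> : [seq p <- iota 0 (size alpha) | is_x (nth Y (rcons alpha l) p)]
    = [seq p <- iota 0 (size alpha) | is_x (nth Y alpha p)].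
  apply: eq_in_filter => p; rewrite mem_iota => /andP[_ pn].
  by rewrite nth_rcons pn.
have take_alpha p : (p <= size alpha)%N -> take p (rcons alpha l) = take p alpha.
  by move=> pn; rewrite -cats1 takel_cat.
rewrite (_ : map _ _ = col_heights alpha); last first.
  apply/eq_in_map => p; rewrite mem_filter mem_iota => /and3P[_ _ pn].
  by rewrite take_alpha // ltnW.
case: l take_alpha => take_alpha /=; last by rewrite cats0.
by rewrite take_alpha // take_size cats1.
Qed.

Lemma size_col_heights alpha : size (col_heights alpha) = count is_x alpha.
Proof.
rewrite size_map size_filter -[in RHS](mkseq_nth Y alpha) count_map.
exact: eq_count.
Qed.

Lemma col_height_default alpha i :
  (count is_x alpha < i)%N -> col_height alpha i = 0%N.
Proof.
case: i => // i lt_i.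
by rewrite /col_height nth_default // -/(col_heights _) size_col_heights.
Qed.

Lemma col_height_rcons_y alpha : col_height (rcons alpha Y) = col_height alpha.
Proof. by rewrite /col_height -!/(col_heights _) col_heights_rcons. Qed.

(** Column 0 is excluded because [i.-1] makes it read the entry of column 1. *)
Lemma col_height_rcons_x alpha i : (0 < i)%N ->
  col_height (rcons alpha X) i =
  if i == (count is_x alpha).+1 then count is_y alpha else col_height alpha i.
Proof.
case: i => // i _; rewrite /col_height -!/(col_heights _) col_heights_rcons /=.
rewrite nth_rcons size_col_heights eqSS.
by case: ltngtP => // lt_i; rewrite nth_default // size_col_heights ltnW.
Qed.

(** * File placements and their rook counts *)

Section Placements.
Variables M N : nat.
Implicit Types (B C Q R : {set 'I_M * 'I_N}) (c d : 'I_M * 'I_N).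

(** All sizes are taken together, since a new column may or may not add a rook; sizes are separated
    only at the end. *)
Definition placements B : {set {set 'I_M * 'I_N}} :=
  [set Q : {set 'I_M * 'I_N} | (Q \subset B) &&
    [forall c in Q, forall d in Q, (c.1 == d.1) ==> (c == d)]].

Lemma placementsP B Q :
  reflect (Q \subset B /\ {in Q &, forall c d, c.1 = d.1 -> c = d})
          (Q \in placements B).
Proof.
rewrite inE; apply: (iffP andP) => -[QB inj]; split=> //.
  move=> c d cQ dQ cd; apply/eqP.
  by have /forall_inP/(_ d dQ)/implyP-> := forall_inP inj c cQ; rewrite ?cd.
apply/forall_inP => c cQ; apply/forall_inP => d dQ; apply/implyP => /eqP cd.
by apply/eqP; apply: inj.
Qed.

Lemma file_placementsE k B :
  file_placements k B = [set Q in placements B | #|Q| == k].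
Proof. by apply/setP=> Q; rewrite !inE -!andbA; congr (_ && _); rewrite andbC. Qed.

(** Sending a rook to its column is injective, with values in 1, ..., [s - 1]. *)
Lemma card_placement s Q : (0 < s)%N ->
  {in Q &, forall c d, c.1 = d.1 -> c = d} ->
  {in Q, forall c, (0 < c.1 < s)%N} -> (#|Q| < s)%N.
Proof.
case: s => // s _ inj col; rewrite ltnS cardE -(size_map (fun c => val c.1)).
rewrite -[leqRHS](size_iota 1 s); apply: uniq_leq_size.
  rewrite map_inj_in_uniq ?enum_uniq // => c d; rewrite !mem_enum => cQ dQ /val_inj.
  exact: inj.
by move=> _ /mapP[c + ->]; rewrite mem_enum mem_iota add1n => /col.
Qed.

(** This keeps the first index of every weight positive, as [w_comm] requires. *)
Lemma nw_rooks_lt B Q c : {in B, forall d, (0 < d.1)%N} ->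
  Q \in placements B -> (0 < c.1)%N -> (nw_rooks Q c < c.1)%N.
Proof.
move=> Bpos /placementsP[/subsetP QB inj] c0; apply: card_placement => //.
  by move=> d e; rewrite !inE => /andP[dQ _] /andP[eQ _]; apply: inj.
by move=> d; rewrite inE => /and3P[/QB/Bpos-> ->].
Qed.

(** The strict bound serves two cases: [j = 0] gives a whole column of height [b], and otherwise the
    cells left uncancelled above a rook in row [j]. *)
Definition column (s j b : nat) : {set 'I_M * 'I_N} :=
  [set c : 'I_M * 'I_N | (nat_of_ord c.1 == s) && (j < c.2 <= b)%N].

Lemma perm_column s j b : (s < M)%N -> (b < N)%N ->
  perm_eq [seq val c.2 | c <- enum (column s j b)] (index_iota j.+1 b.+1).
Proof.
move=> sM bN; apply: uniq_perm; [|exact: iota_uniq|].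
  rewrite map_inj_in_uniq ?enum_uniq // => -[c1 c2] [d1 d2].
  rewrite !mem_enum !inE /= => /andP[/eqP c1s _] /andP[/eqP d1s _] /val_inj->.
  by congr pair; apply: ord_inj; rewrite /= c1s.
move=> t; rewrite mem_index_iota ltnS; apply/mapP/idP => [[c + ->]|/andP[jt tb]].
  by rewrite mem_enum inE => /andP[].
exists (Ordinal sM, Ordinal (leq_ltn_trans tb bN)) => //.
by rewrite mem_enum inE /= eqxx jt.
Qed.

(** * Adding a column to the right of a board *)

Section AddColumn.
Variables (B : {set 'I_M * 'I_N}) (a b : nat).
Hypothesis Bcol : {in B, forall c : 'I_M * 'I_N, (0 < c.1 <= a)%N && (0 < c.2)%N}.
Let C := column a.+1 0 b.

Let BC_col c d : c \in B -> d \in C -> (c.1 == d.1) = false.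
Proof.
move=> /Bcol /andP[/andP[_ ca] _]; rewrite inE => /andP[/eqP da _].
by apply/negbTE/eqP => cd; move: ca; rewrite cd da ltnn.
Qed.

Let notBC c : c \in B -> c \in C -> False.
Proof. by move=> cB cC; have := BC_col cB cC; rewrite eqxx. Qed.

(** A placement in [B :|: C] either lies in [B] or has exactly one rook in the single column [C];
    removing that rook leaves a placement in [B]. *)
Lemma sum_placements_column (V : nmodType) (G : {set 'I_M * 'I_N} -> V) :
  \sum_(Q in placements (B :|: C)) G Q =
  \sum_(Q in placements B) (G Q + \sum_(c in C) G (c |: Q)).
Proof.
rewrite big_split /= (bigID (fun Q => Q \subset B)) /=; congr (_ + _).
  apply: eq_bigl => Q; apply/andP/placementsP => [[/placementsP[] _]|[QB inj]] //.
  by split=> //; apply/placementsP; split=> //; apply: subset_trans QB (subsetUl _ _).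
(* For a fixed [c], the maps adding and removing [c] match placements in [B] with placements
   containing [c]. *)
rewrite exchange_big /= [RHS](eq_bigr (fun c =>
  \sum_(Q in placements (B :|: C) | c \in Q) G Q)); last first.
  move=> c cC.
  rewrite [RHS](reindex_onto (fun Q => c |: Q) (fun Q => Q :\ c)); last first.
    by move=> Q /andP[_ cQ]; apply: setD1K.
  apply: eq_bigl => Q; rewrite setU11 andbT.
  apply/placementsP/andP => [[QB inj]|[/placementsP[QB inj] /eqP QE]].
    have cQ : c \notin Q by apply/negP => /(subsetP QB) /notBC; apply.
    split; last by rewrite setU1K.
    apply/placementsP; split.
      by rewrite subUset sub1set inE cC orbT; apply: subset_trans QB (subsetUl _ _).
    move=> d e; rewrite !inE => /predU1P[->|dQ] /predU1P[->|eQ] // /eqP.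
    - by rewrite eq_sym (BC_col (subsetP QB _ eQ)).
    - by rewrite (BC_col (subsetP QB _ dQ)).
    by move/eqP; apply: inj.
  split=> [|d e dQ eQ]; last by apply: inj; rewrite inE (dQ, eQ) orbT.
  apply/subsetP => d dQ; have dcQ : d \in c |: Q by rewrite inE dQ orbT.
  have := subsetP QB d dcQ; rewrite inE => /orP[//|dC].
  have dc : d = c.
    apply: inj; rewrite ?setU11 //; apply: ord_inj.
    by move: dC cC; rewrite !inE => /andP[/eqP-> _] /andP[/eqP-> _].
  by move: dQ; rewrite -QE dc !inE eqxx.
(* Each placement not inside [B] is counted once, for its only rook in [C]. *)
rewrite (exchange_big_dep (fun Q => (Q \in placements (B :|: C)) && ~~ (Q \subset B))) /=.
  apply: eq_bigr => Q /andP[/placementsP[QB inj] /subsetPn[c cQ cB]].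
  have cC : c \in C by have := subsetP QB c cQ; rewrite inE (negbTE cB).
  rewrite (big_pred1 c) // => d; apply/andP/eqP => [[dC /andP[_ dQ]]|->]; last first.
    by split=> //; rewrite cQ andbT; apply/placementsP.
  apply: inj => //; apply: ord_inj.
  by move: dC cC; rewrite !inE => /andP[/eqP-> _] /andP[/eqP-> _].
move=> c Q cC /andP[-> cQ] /=; apply/subsetPn; exists c => //.
by apply/negP => /notBC; apply.
Qed.

(** Rooks cancel only within their own column, and [B] and [C] share none. *)
Lemma uncancelled_setU R Q : Q \subset B -> R \subset C ->
  uncancelled (B :|: C) (R :|: Q) = uncancelled B Q :|: uncancelled C R.
Proof.
move: BC_col notBC; move: (C) => D BD_col notBD /subsetP QB /subsetP RD.
apply/setP => c; rewrite !inE.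
have [cB|cB] := boolP (c \in B); last first.
  have -> : (c \in Q) = false by apply: contraNF cB => /QB.
  rewrite andbF /= orbF; have [cC|] := boolP (c \in D); last by rewrite !andbF.
  congr (_ && ~~ _); apply/existsP/existsP => -[d]; rewrite ?inE.
    case/andP=> /orP[dR|/QB dB] /andP[cd dc]; first by exists d; rewrite dR cd.
    by move: cd; rewrite (BD_col _ _ dB).
  by case/andP=> dR cd; exists d; rewrite inE dR.
have cC : (c \in D) = false by apply/negP => /(notBD _ cB).
have -> : (c \in R) = false by apply/negP => /RD; rewrite cC.
rewrite cC !andbF /= andbT orbF; congr (_ && ~~ _).
apply/existsP/existsP => -[d]; rewrite ?inE.
  case/andP=> /orP[/RD dC|dQ] /andP[cd dc]; last by exists d; rewrite dQ cd.
  by move: cd; rewrite eq_sym (BD_col _ _ cB).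
by case/andP=> dQ cd; exists d; rewrite inE dQ orbT.
Qed.

Lemma uncancelled_column0 : uncancelled C set0 = C.
Proof.
apply/setP=> c; rewrite /uncancelled setD0 inE.
by case: existsP => [[d]|_]; rewrite ?andbT // inE.
Qed.

Lemma uncancelled_column1 c : c \in C ->
  uncancelled C [set c] = column a.+1 c.2 b.
Proof.
rewrite inE => /andP[/eqP c1 /andP[c0 cb]]; apply/setP => d; rewrite !inE.
have [d1|_] := eqVneq (nat_of_ord d.1) a.+1; last by rewrite andbF.
have cd1 : c.1 = d.1 by apply: ord_inj; rewrite /= c1 d1.
have -> : [exists e in [set c], (e.1 == d.1) && (d.2 < e.2)%N] = (d.2 < c.2)%N.
  apply/existsP/idP => [[e /and3P[/set1P->]]//|dc].
  by exists c; rewrite inE eqxx cd1 eqxx.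
have -> : (d == c) = (val d.2 == c.2).
  by rewrite [d]surjective_pairing [c]surjective_pairing xpair_eqE cd1 eqxx.
rewrite /= -leqNgt; case: (ltngtP (val c.2) (val d.2)) => cd; rewrite /= ?andbF ?andbT //.
by rewrite (leq_ltn_trans _ cd).
Qed.

Definition rooks_above Q (t : nat) : nat := #|[set d : 'I_M * 'I_N in Q | (t <= d.2)%N]|.

Lemma nw_rooks_setU R Q c : R \subset C -> (c.1 <= a.+1)%N ->
  nw_rooks (R :|: Q) c = nw_rooks Q c.
Proof.
move=> /subsetP RC ca; congr #|pred_of_set _|; apply/setP => d; rewrite !inE.
have [/RC|//] := boolP (d \in R); rewrite inE => /andP[/eqP-> _].
by rewrite ltnNge ca /= !andbF.
Qed.

(** Every rook of [Q] is strictly to the left of the new column, so only its row matters. *)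
Lemma nw_rooks_column Q c : Q \subset B -> nat_of_ord c.1 = a.+1 ->
  nw_rooks Q c = rooks_above Q c.2.
Proof.
move=> /subsetP QB ca; congr #|pred_of_set _|; apply/setP => d; rewrite !inE ca.
by have [/QB/Bcol/andP[/andP[_]]|//] := boolP (d \in Q); rewrite ltnS => ->.
Qed.

End AddColumn.
End Placements.

(** * Products of commuting factors over finite sets *)

Lemma prod_enum_comm (A : pzRingType) (T : finType) (F : T -> A) (S : {set T})
    (r : seq T) :
  {in S &, forall i j, GRing.comm (F i) (F j)} -> uniq r -> r =i S ->
  \prod_(i in S) F i = \prod_(i <- r) F i.
Proof.
move=> Fcomm Ur rS; rewrite -big_filter; have [e _ [Ue mem_e] _] := big_enumP.
apply: perm_prod_comm => [i j|]; first by rewrite !mem_e; apply: Fcomm.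
by apply: uniq_perm => // i; rewrite mem_e rS.
Qed.

Lemma prod_setU_comm (A : pzRingType) (T : finType) (F : T -> A) (S1 S2 : {set T}) :
  [disjoint S1 & S2] -> {in S1 :|: S2 &, forall i j, GRing.comm (F i) (F j)} ->
  \prod_(i in S1 :|: S2) F i = \prod_(i in S1) F i * \prod_(i in S2) F i.
Proof.
move=> dis12 Fcomm; rewrite (@prod_enum_comm _ _ F _ (enum S1 ++ enum S2)) //; first last.
- by move=> i; rewrite mem_cat !mem_enum inE.
- rewrite cat_uniq !enum_uniq andbT /=; apply/hasPn => i; rewrite !mem_enum => i2.
  by rewrite (disjointFl dis12 i2).
have prod_enum (S : {set T}) : S \subset S1 :|: S2 ->
    \prod_(i <- enum S) F i = \prod_(i in S) F i.
  move=> /subsetP sS; symmetry; apply: prod_enum_comm; last exact: mem_enum.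
    by move=> i j /sS iS /sS; apply: Fcomm.
  exact: enum_uniq.
by rewrite big_cat !prod_enum ?subsetUl ?subsetUr.
Qed.

Definition placement_weight (A : pzRingType) (w : nat -> nat -> A) (M N : nat)
    (B Q : {set 'I_M * 'I_N}) : A :=
  \prod_(c in uncancelled B Q) w (c.1 - nw_rooks Q c)%N c.2.

(** * Right multiplication by [x] as the addition of a column *)

Section WeightRecursion.
Variables (A : pzRingType) (x y : A) (w : nat -> nat -> A).
Hypothesis w_comm : forall s t s' t' : nat,
  (0 < s)%N -> (0 < t)%N -> (0 < s')%N -> (0 < t')%N ->
  w s t * w s' t' = w s' t' * w s t.
Hypothesis yx : y * x = w 1%N 1%N * x * y + y.
Hypothesis xw : forall s t : nat, (0 < s)%N -> (0 < t)%N ->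
  x * w s t = w s.+1 t * x.
Hypothesis yw : forall s t : nat, (0 < s)%N -> (0 < t)%N ->
  y * w s t = w s t.+1 * y.

Variables (M N : nat) (B : {set 'I_M * 'I_N}) (a b : nat).
Hypothesis Bcol : {in B, forall c : 'I_M * 'I_N, (0 < c.1 <= a)%N && (0 < c.2)%N}.
Hypotheses (aM : (a.+1 < M)%N) (bN : (b < N)%N).
Let C : {set 'I_M * 'I_N} := column M N a.+1 0 b.

Let card_placement_le Q : Q \in placements B -> (#|Q| <= a)%N.
Proof.
case/placementsP => /subsetP QB inj; rewrite -ltnS; apply: card_placement => //.
by move=> c /QB /Bcol /andP[].
Qed.

(** Rooks in the last column are north-west of no cell, so the weights on [B] are unchanged. Both
    the empty [R] and a single rook are covered through [j]. *)
Lemma placement_weight_column j (Q R : {set 'I_M * 'I_N}) :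
  Q \in placements B -> R \subset C -> uncancelled C R = column M N a.+1 j b ->
  placement_weight w (B :|: C) (R :|: Q) =
  placement_weight w B Q * \prod_(j.+1 <= t < b.+1) w (a.+1 - rooks_above Q t) t.
Proof.
move=> Qpl RC colR; have /placementsP[QB inj] := Qpl.
have aQ t : (rooks_above Q t < a.+1)%N.
  rewrite ltnS; apply: leq_trans (card_placement_le Qpl); apply: subset_leq_card.
  by apply/subsetP => c; rewrite inE => /andP[].
have uBQ c : c \in uncancelled B Q -> c \in B by rewrite !inE => /andP[/andP[]].
pose F (c : 'I_M * 'I_N) := w (c.1 - nw_rooks Q c) c.2.
(* The first bound lets [R] be dropped from the rook counts; the other two make both indices
   positive, so that the factors commute. *)
have sub_lt c : c \in uncancelled B Q :|: column M N a.+1 j b ->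
    [&& (c.1 <= a.+1)%N, (nw_rooks Q c < c.1)%N & (0 < c.2)%N].
  rewrite in_setU => /orP[/uBQ cB|].
    have /andP[/andP[c0 ca] ->] := Bcol cB; rewrite (leq_trans ca) // andbT.
    by apply: nw_rooks_lt Qpl c0 => d /Bcol /andP[/andP[]].
  rewrite inE => /andP[/eqP ca /andP[jc _]].
  by rewrite (nw_rooks_column Bcol QB ca) ca leqnn aQ (leq_ltn_trans _ jc).
rewrite /placement_weight (uncancelled_setU Bcol QB RC) colR.
rewrite (eq_bigr F) => [|c /sub_lt /and3P[ca _ _]]; last by rewrite (nw_rooks_setU _ RC).
have Fcomm : {in uncancelled B Q :|: column M N a.+1 j b &,
    forall c d, GRing.comm (F c) (F d)}.
  move=> c d /sub_lt /and3P[_ cQ c0] /sub_lt /and3P[_ dQ d0].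
  by apply: w_comm; rewrite ?subn_gt0.
rewrite prod_setU_comm //; last first.
  rewrite -setI_eq0; apply/eqP/setP => c; rewrite in_set0 in_setI.
  apply/negP => /andP[/uBQ /Bcol /andP[/andP[_ ca] _]]; rewrite inE => /andP[/eqP cE _].
  by rewrite -ltnS -cE ltnn in ca.
congr (_ * _); rewrite -(perm_prod_comm _ (perm_column j aM bN)); last first.
  move=> t t'; rewrite !(perm_mem (perm_column j aM bN)) !mem_index_iota.
  move=> /andP[jt _] /andP[jt' _].
  by apply: w_comm; rewrite ?subn_gt0 ?aQ ?(leq_ltn_trans _ jt) ?(leq_ltn_trans _ jt').
rewrite big_map (@prod_enum_comm _ _ F _ (enum (column M N a.+1 j b))) ?enum_uniq //.
- apply: eq_big_seq => c; rewrite mem_enum inE => /andP[/eqP ca _].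
  by rewrite /F (nw_rooks_column Bcol QB ca) ca.
- by move=> c d cC dC; apply: Fcomm; rewrite in_setU (cC, dC) orbT.
by move=> c; rewrite mem_enum.
Qed.

(** The identity holds for each [Q] separately: [Q] itself and its extensions by one rook in the new
    column match the summands of [exp_y_mul_x]. *)
Lemma placement_sum_column :
  \sum_(Q in placements (B :|: C))
    placement_weight w (B :|: C) Q * (x ^+ (a.+1 - #|Q|) * y ^+ b) =
  (\sum_(Q in placements B)
    placement_weight w B Q * (x ^+ (a - #|Q|) * y ^+ b)) * x.
Proof.
rewrite (sum_placements_column b Bcol) mulr_suml; apply: eq_bigr => Q Qpl.
have Qa := card_placement_le Qpl; have /placementsP[QB _] := Qpl.
have pos t : (a - #|Q| < a.+1 - rooks_above Q t)%N.
  rewrite -subSn // leq_sub2l //; apply: subset_leq_card.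
  by apply/subsetP => c; rewrite inE => /andP[].
(* All rooks lie in rows at least 1, so row 1 sees every rook of [Q]. *)
have e1 : (a.+1 - rooks_above Q 1 = (a - #|Q|).+1)%N.
  rewrite -subSn //; congr (_ - #|pred_of_set _|)%N; apply/setP => c; rewrite inE.
  by apply: andb_idr => /(subsetP QB) /Bcol /andP[].
rewrite -!mulrA (exp_y_mul_x w_comm yx yw) mulrDr mulrDr; congr (_ + _).
  rewrite -[X in placement_weight _ _ X]set0U.
  rewrite (placement_weight_column Qpl (sub0set _) (uncancelled_column0 _ _ _ _)).
  by rewrite subSn // -[LHS]mulrA (column_without_rook w_comm yx xw yw) // -!mulrA.
rewrite mulr_sumr mulr_sumr -(perm_big _ (perm_column 0 aM bN)) big_map big_enum /=.
apply: eq_bigr => c cC.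
rewrite (placement_weight_column Qpl _ (uncancelled_column1 cC)) ?sub1set //.
have cQ : c \notin Q.
  apply/negP => /(subsetP QB) /Bcol /andP[/andP[_ ca] _].
  by move: cC ca; rewrite inE => /andP[/eqP-> _]; rewrite ltnn.
(* The added rook uses up the new [x], leaving the exponent [a - #|Q|]. *)
rewrite cardsU1 cQ add1n subSS -!mulrA (column_with_rook w_comm yx xw yw) //.
by move: cC; rewrite inE => /andP[_].
Qed.

End WeightRecursion.

(** * Ferrers boards of words and induction on the last letter *)

Lemma ferrers_board_rcons_y M N alpha :
  ferrers_board M N (rcons alpha Y) = ferrers_board M N alpha.
Proof. by apply/setP => c; rewrite !inE col_height_rcons_y. Qed.

Lemma ferrers_board_rcons_x M N alpha : (count is_x alpha < M)%N ->
  ferrers_board M N (rcons alpha X) =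
  ferrers_board M N alpha :|: column M.+1 N.+1 (count is_x alpha).+1 0 (count is_y alpha).
Proof.
move=> aM; apply/setP => c; rewrite !inE.
have [->//|c0] := posnP (nat_of_ord c.1); rewrite col_height_rcons_x //.
have [->|_] := eqVneq (nat_of_ord c.1) _; last by rewrite orbF.
(* In the new column the old height is the default 0, so the old board has no cell there. *)
by rewrite aM col_height_default //=; case: (nat_of_ord c.2).
Qed.

(** The definition bounds columns only by the ambient [M]; those past the last [x] are empty because
    their height is the default 0. *)
Lemma mem_ferrers_board M N alpha c : c \in ferrers_board M N alpha ->
  (0 < c.1 <= count is_x alpha)%N && (0 < c.2)%N.
Proof.
rewrite inE => /andP[/andP[-> _] /andP[c0 ch]]; rewrite c0 andbT leqNgt.
by apply/negP => /col_height_default h0; rewrite h0 leqNgt c0 in ch.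
Qed.

(* The ambient [M] and [N] stay fixed along the induction on the word, so that
   all the boards have the same type. *)
Lemma word_val_placements (A : pzRingType) (x y : A) (w : nat -> nat -> A)
    (w_comm : forall s t s' t' : nat,
      (0 < s)%N -> (0 < t)%N -> (0 < s')%N -> (0 < t')%N ->
      w s t * w s' t' = w s' t' * w s t)
    (yx : y * x = w 1%N 1%N * x * y + y)
    (xw : forall s t : nat, (0 < s)%N -> (0 < t)%N ->
      x * w s t = w s.+1 t * x)
    (yw : forall s t : nat, (0 < s)%N -> (0 < t)%N ->
      y * w s t = w s t.+1 * y)
    (M N : nat) (alpha : seq letter) :
  (count is_x alpha <= M)%N -> (count is_y alpha <= N)%N ->
  word_val x y alpha =
    \sum_(Q in placements (ferrers_board M N alpha))
      placement_weight w (ferrers_board M N alpha) Q *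
        (x ^+ (count is_x alpha - #|Q|) * y ^+ count is_y alpha).
Proof.
elim/last_ind: alpha => [_ _|alpha l IH].
  have -> : ferrers_board M N [::] = set0.
    apply/setP => c; rewrite in_set0.
    by apply/negP => /mem_ferrers_board /andP[/andP[/leq_trans h /h]].
  rewrite (big_pred1 set0) => [|Q]; last first.
    apply/placementsP/eqP => [[/subsetP Q0 _]|->].
      by apply/setP => c; rewrite inE; apply/negP => /Q0; rewrite inE.
    by split=> // c d; rewrite inE.
  rewrite /word_val /placement_weight big_nil big1 ?mulr1 // => c.
  by rewrite !inE.
rewrite -cats1 !count_cat /= !addn0 cats1 => aM bN.
have {}IH := IH (leq_trans (leq_addr _ _) aM) (leq_trans (leq_addr _ _) bN).
have -> : word_val x y (rcons alpha l) = word_val x y alpha * (if is_x l then x else y).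
  by rewrite /word_val -cats1 big_cat big_seq1.
rewrite {}IH; case: l aM bN => /= aM bN; rewrite !addn0 ?addn1 in aM bN *.
  rewrite ferrers_board_rcons_x // (placement_sum_column w_comm yx xw yw) //.
  exact: mem_ferrers_board.
rewrite ferrers_board_rcons_y mulr_suml; apply: eq_bigr => Q _.
by rewrite -!mulrA -exprSr.
Qed.

Theorem theorem4p4 (A : pzRingType) (x y : A) (w : nat -> nat -> A)
    (w_comm : forall s t s' t' : nat,
      (0 < s)%N -> (0 < t)%N -> (0 < s')%N -> (0 < t')%N ->
      w s t * w s' t' = w s' t' * w s t)
    (yx : y * x = w 1%N 1%N * x * y + y)
    (xw : forall s t : nat, (0 < s)%N -> (0 < t)%N ->
      x * w s t = w s.+1 t * x)
    (yw : forall s t : nat, (0 < s)%N -> (0 < t)%N ->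
      y * w s t = w s t.+1 * y)
    (m n : nat) (alpha : seq letter)
    (alpha_x : count is_x alpha = m) (alpha_y : count is_y alpha = n) :
  word_val x y alpha =
    \sum_(k < m.+1)
      file_number w k (ferrers_board m n alpha) * x ^+ (m - k) * y ^+ n.
Proof.
rewrite (word_val_placements w_comm yx xw yw (M := m) (N := n)) ?alpha_x ?alpha_y //.
set B := ferrers_board m n alpha.
have card_le Q : Q \in placements B -> (#|Q| < m.+1)%N.
  case/placementsP => /subsetP QB inj; apply: card_placement => // c /QB.
  by move=> /mem_ferrers_board /andP[]; rewrite alpha_x.
(* Placements are sorted by their number of rooks; [card_le] ensures that [inord] preserves it. *)
rewrite (partition_big (fun Q : {set _} => inord #|Q| : 'I_m.+1) predT) //=.
apply: eq_bigr => k _; rewrite /file_number -mulrA mulr_suml.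
apply: eq_big => Q.
  rewrite file_placementsE [RHS]inE; case: (boolP (Q \in _)) => //= /card_le Qm.
  by rewrite -val_eqE /= inordK.
by case/andP=> /card_le Qm /eqP <-; rewrite inordK.
Qed.
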